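(* Let $A\in\mathbb{R}^{n\times n}$ be an M-matrix of the form $A=I-C$ with $C\ge 0$ and $\rho(C)\le 1$, and suppose that $A$ has a triplet representation $(-\mathrm{offdiag}(A),\boldsymbol{u},\boldsymbol{v})$. Consider the sequences $$W_0=A-I,\quad Z_0=2(A+I),\qquad W_{\ell+1}=-W_\ell Z_\ell^{-1}W_\ell,\quad Z_{\ell+1}=Z_\ell+2W_{\ell+1},\qquad \ell=0,1,\ldots$$ Then these sequences are well defined (every $Z_\ell$ is invertible). Moreover, for every $\ell\ge 0$, $(-\mathrm{offdiag}(Z_\ell),\boldsymbol{u},\boldsymbol{v}_\ell)$ is a triplet representation of $Z_\ell$, where $$\boldsymbol{v}_\ell=\boldsymbol{p}_\ell-2W_\ell\boldsymbol{u},\qquad \boldsymbol{p}_0=4\boldsymbol{v},\qquad \boldsymbol{p}_{\ell+1}=\boldsymbol{p}_\ell-2W_\ell Z_\ell^{-1}\boldsymbol{p}_\ell,\quad \ell=0,1,\ldots$$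
   Context: Inequalities between real matrices or vectors are entrywise: $B\ge 0$ means all entries are $\ge 0$, and $\boldsymbol{u}>0$ means all entries are $>0$. $\rho(\cdot)$ denotes the spectral radius. A real square matrix $A$ is an M-matrix if $A=\alpha I-B$ with $B\ge 0$ and $\alpha\ge\rho(B)$. For a square matrix $M$, $\mathrm{offdiag}(M)$ is the matrix with the same off-diagonal entries as $M$ and zero diagonal. A triplet representation of an M-matrix $M$ is a triple $(-\mathrm{offdiag}(M),\boldsymbol{u},\boldsymbol{v})$ where $\boldsymbol{u},\boldsymbol{v}$ are real vectors with $\boldsymbol{u}>0$, $\boldsymbol{v}\ge 0$ and $M\boldsymbol{u}=\boldsymbol{v}$ (the matrix $-\mathrm{offdiag}(M)$ is nonnegative since $M$ is an M-matrix). *)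

(* Defs.v *)
From mathcomp Require Import all_boot all_order all_algebra.
From mathcomp Require Import classical_sets reals.
From mathcomp Require Import complex.

Set Implicit Arguments.
Unset Strict Implicit.
Unset Printing Implicit Defensive.

Import Order.TTheory GRing.Theory Num.Theory.

Local Open Scope classical_set_scope.
Local Open Scope ring_scope.

(* The eigenvalues are the complex ones. The set is finite, so the supremum is
   a maximum; for n = 0 it is empty and the supremum is 0. *)
Definition spectral_radius (R : realType) (n : nat) (M : 'M[R]_n) : R :=
  sup [set Normc.normc z |
        z in [set z : complex R | eigenvalue (map_mx (real_complex R) M) z]].

Definition M_matrix (R : realType) (n : nat) (A : 'M[R]_n) : Prop :=
  exists (alpha : R) (B : 'M[R]_n),
    [/\ A = alpha%:M - B, B \is a mxOver Num.nneg & spectral_radius B <= alpha].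

Definition offdiag (R : realType) (n : nat) (M : 'M[R]_n) : 'M[R]_n :=
  \matrix_(i, j) (if i == j then 0 else M i j).

Definition triplet_representation (R : realType) (n : nat)
    (M N : 'M[R]_n) (u v : 'cV[R]_n) : Prop :=
  M_matrix M /\
  [/\ N = - offdiag M, u \is a mxOver Num.pos, v \is a mxOver Num.nneg
    & M *m u = v].

(* Main.v *)
(** Put [N = - W].  The identity [Z u = p + 2 N u] is preserved by the
    recursion, and it turns into
    [2 Z' u = Z u + p + 2 N Z^-1 p] for the next iterate [Z'].  Hence [Z u]
    stays entrywise positive even when [v] has zero entries.  A matrix with
    nonpositive off-diagonal entries that maps some [u > 0] to a positive vector
    is invertible with nonnegative inverse, which gives [Z' <= Z <= 4 I],
    [N' >= 0] and [p' >= 0].  Finally [Z u >= 0] means [(4 I - Z) u <= 4 u], which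
    bounds the spectral radius of [4 I - Z >= 0] by [4]. *)
Require Import Defs.
From mathcomp Require Import all_boot all_order all_algebra.
From mathcomp Require Import classical_sets reals.
From mathcomp Require Import complex ring lra.

Import Order.TTheory GRing.Theory Num.Theory.

Local Open Scope ring_scope.

Lemma mxOver_nnegD (R : numDomainType) (m n : nat) (M N : 'M[R]_(m, n)) :
  M \is a mxOver Num.nneg -> N \is a mxOver Num.nneg ->
  M + N \is a mxOver Num.nneg.
Proof.
by move=> /mxOverP M0 /mxOverP N0; apply/mxOverP => i j; rewrite mxE rpredD.
Qed.

(** The upper half of the Collatz-Wielandt bound. Working over a [numFieldType] lets it apply to a
    real matrix viewed over the complex numbers, where eigenvalues live. *)
Lemma eigenvalue_norm_le (K : numFieldType) (n : nat) (B : 'M[K]_n)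
    (u : 'cV[K]_n) (a z : K) :
  B \is a mxOver Num.nneg -> u \is a mxOver Num.pos ->
  (forall i, (B *m u) i 0 <= a * u i 0) -> eigenvalue B z -> `|z| <= a.
Proof.
move=> /mxOverP B0 /mxOverP u0 Bu /eigenvalueP[w wB w0].
have {}u0 i : 0 < u i 0 by apply: u0.
have {}B0 i j : 0 <= B i j by apply: B0.
(* Pair the left eigenvector inequality [|z| |w| <= |w| B] with [u]. *)
have s_gt0 : 0 < \sum_j `|w 0 j| * u j 0.
  have [j wj] : exists j, w 0 j != 0.
    apply/existsP; apply: contra_neqT w0 => /existsPn w0.
    by apply/rowP => j; rewrite mxE; apply/eqP; have := w0 j; rewrite negbK.
  rewrite (bigD1 j) //= ltr_pwDl ?mulr_gt0 ?normr_gt0 //.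
  by apply: sumr_ge0 => k _; rewrite mulr_ge0 // ltW.
rewrite -(ler_pM2r s_gt0) !mulr_sumr.
apply: (@le_trans _ _ (\sum_j \sum_i `|w 0 i| * (B i j * u j 0))).
  apply: ler_sum => j _.
  rewrite mulrA -normrM.
  have -> : z * w 0 j = (w *m B) 0 j by rewrite wB mxE.
  under eq_bigr do rewrite mulrA.
  rewrite -mulr_suml ler_wpM2r ?(ltW (u0 j)) // mxE.
  apply: le_trans (ler_norm_sum _ _ _) _; apply: ler_sum => i _.
  by rewrite normrM (ger0_norm (B0 _ _)).
rewrite exchange_big /=; apply: ler_sum => i _.
rewrite -mulr_sumr mulrCA ler_wpM2l //.
by have := Bu i; rewrite mxE.
Qed.

Lemma spectral_radius_le (R : realType) (n : nat) (B : 'M[R]_n)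
    (u : 'cV[R]_n) (a : R) :
  0 <= a -> B \is a mxOver Num.nneg -> u \is a mxOver Num.pos ->
  (forall i, (B *m u) i 0 <= a * u i 0) -> spectral_radius B <= a.
Proof.
move=> a0 /mxOverP B0 /mxOverP u0 Bu; rewrite /spectral_radius.
set E := (X in sup X).
have ubE : ubound E a.
  move=> _ [z /= zB <-].
  suff : `|z| <= real_complex R a by rewrite lecR.
  apply: (@eigenvalue_norm_le _ _ _ (map_mx (real_complex R) u) _ _ _ _ _ zB).
  - by apply/mxOverP => i j; rewrite mxE nnegrE ler0c; apply: B0.
  - by apply/mxOverP => i j; rewrite mxE posrE ltcR; apply: u0.
  - by move=> i; rewrite -map_mxM !mxE -rmorphM lecR; have := Bu i; rewrite mxE.
(* If [E] is empty, as for [n = 0], its [sup] is 0 and the hypothesis [0 <= a] closes the case. *)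
have [->|E0] := eqVneq E set0; first by rewrite sup0.
by apply: ge_sup => //; apply/set0P.
Qed.

(** Minimum principle: let [i] minimise [q i = x i 0 / u i 0]. Then [x - q i *: u] is nonnegative
    and vanishes at [i], so its image under [Z] is at most 0 there. If [q i < 0], that image is also
    [Z x - q i Z u > 0] at [i], a contradiction. *)
Lemma Z_matrix_monotone (R : realFieldType) (n : nat) (Z : 'M[R]_n)
    (u x : 'cV[R]_n) :
  (forall i j, i != j -> Z i j <= 0) -> u \is a mxOver Num.pos ->
  Z *m u \is a mxOver Num.pos -> Z *m x \is a mxOver Num.nneg ->
  x \is a mxOver Num.nneg.
Proof.
move=> Zoff /mxOverP u0 /mxOverP Zu0 /mxOverP Zx0.
have {}u0 i : 0 < u i 0 by apply: u0.
apply/mxOverP => i0 k; rewrite (ord1 k) {k} nnegrE.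
pose q i := x i 0 / u i 0.
case: (@Order.TotalTheory.arg_minP _ _ _ i0 predT q isT) => i _ qmin.
have xge j : q i * u j 0 <= x j 0 by rewrite -ler_pdivlMr //; apply: qmin.
have [qi0|qi0] := leP 0 (q i).
  by apply: le_trans (xge i0); rewrite mulr_ge0 // ltW.
have Zy : (Z *m (x - q i *: u)) i 0 <= 0.
  rewrite mxE (bigD1 i) //= !mxE divfK ?gt_eqF // subrr mulr0 add0r.
  apply: sumr_le0 => j ji; rewrite mulr_le0_ge0 //; first by rewrite Zoff // eq_sym.
  by rewrite !mxE subr_ge0 xge.
have := Zx0 i 0; have := Zu0 i 0; move: Zy.
rewrite mulmxBr -scalemxAr; move: (Z *m x) (Z *m u) => a b.
rewrite !mxE posrE nnegrE.
by nra.
Qed.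

(** Monotonicity applies to a kernel vector and to its opposite, so both are nonnegative and the
    vector is 0. The transpose appears because [kermx] is a left kernel. *)
Lemma Z_matrix_unitmx (R : realFieldType) (n : nat) (Z : 'M[R]_n)
    (u : 'cV[R]_n) :
  (forall i j, i != j -> Z i j <= 0) -> u \is a mxOver Num.pos ->
  Z *m u \is a mxOver Num.pos -> Z \in unitmx.
Proof.
move=> Zoff u0 Zu0; rewrite -unitmx_tr -row_free_unit -kermx_eq0.
apply/eqP/row_matrixP => i; rewrite row0.
have /sub_kermxP/(congr1 trmx) : (row i (kermx Z^T) <= kermx Z^T)%MS by exact: row_sub.
rewrite trmx_mul trmxK trmx0; move: (row i _) => y Zy.
have ypos : y^T \is a mxOver Num.nneg.
  by apply: (Z_matrix_monotone _ _ Z u _ Zoff u0 Zu0); rewrite Zy mxOver0 ?nnegrE.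
have yneg : - y^T \is a mxOver Num.nneg.
  by apply: (Z_matrix_monotone _ _ Z u _ Zoff u0 Zu0); rewrite mulmxN Zy oppr0 mxOver0 ?nnegrE.
apply/rowP => j; apply/eqP; rewrite mxE eq_le.
move/mxOverP: ypos => /(_ j 0); move/mxOverP: yneg => /(_ j 0).
by rewrite !mxE !nnegrE oppr_ge0 => -> ->.
Qed.

(** [Z] maps column [j] of its inverse to a unit vector, which is nonnegative, so monotonicity
    applies. *)
Lemma Z_matrix_invmx_nneg (R : realFieldType) (n : nat) (Z : 'M[R]_n)
    (u : 'cV[R]_n) :
  (forall i j, i != j -> Z i j <= 0) -> u \is a mxOver Num.pos ->
  Z *m u \is a mxOver Num.pos -> invmx Z \is a mxOver Num.nneg.
Proof.
move=> Zoff u0 Zu0; apply/mxOverP => i j.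
suff /mxOverP/(_ i 0) : col j (invmx Z) \is a mxOver Num.nneg by rewrite mxE.
apply: (Z_matrix_monotone _ _ Z u _ Zoff u0 Zu0).
rewrite colE mulmxA mulmxV ?(Z_matrix_unitmx _ _ _ _ Zoff u0 Zu0) // mul1mx.
by apply/mxOverP => k l; rewrite !mxE nnegrE ler0n.
Qed.

Theorem theorem10 (R : realType) (n : nat) (A C : 'M[R]_n) (u v : 'cV[R]_n)
  (hAC : A = 1%:M - C)
  (hC : C \is a mxOver Num.nneg)
  (hrho : spectral_radius C <= 1)
  (hA : triplet_representation A (- offdiag A) u v)
  (W Z : nat -> 'M[R]_n) (p : nat -> 'cV[R]_n)
  (hW0 : W 0%N = A - 1%:M)
  (hZ0 : Z 0%N = 2 *: (A + 1%:M))
  (hW : forall l : nat, W l.+1 = - (W l *m invmx (Z l) *m W l))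
  (hZ : forall l : nat, Z l.+1 = Z l + 2 *: W l.+1)
  (hp0 : p 0%N = 4 *: v)
  (hp : forall l : nat, p l.+1 = p l - 2 *: (W l *m invmx (Z l) *m p l)) :
  (forall l : nat, Z l \in unitmx) /\
  (forall l : nat,
     triplet_representation (Z l) (- offdiag (Z l)) u (p l - 2 *: (W l *m u))).
Proof.
have [_ [_ u0 v0 Au]] := hA.
have Zoff l : 4%:M - Z l \is a mxOver Num.nneg ->
    forall i j, i != j -> Z l i j <= 0.
  move=> /mxOverP Zl i j ij; have := Zl i j.
  by rewrite !mxE (negbTE ij) mulr0n sub0r nnegrE oppr_ge0.
(* The bound on [4%:M - Z l] serves twice: it gives the off-diagonal signs of [Z l], and the
   nonnegative matrix of its M-matrix splitting. *)
have inv l : [/\ - W l \is a mxOver Num.nneg, 4%:M - Z l \is a mxOver Num.nneg,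
    p l \is a mxOver Num.nneg, Z l *m u = p l - 2 *: (W l *m u)
    & Z l *m u \is a mxOver Num.pos].
  elim: l => [|l [W0 Z0 p0 Zu Zu0]].
    have W0E : W 0%N = - C by rewrite hW0 hAC addrAC subrr add0r.
    have Z0E : Z 0%N = 4%:M - 2 *: C.
      by rewrite hZ0 hAC; apply/matrixP => i j; rewrite !mxE; case: eqP => _ /=; ring.
    have CuE : C *m u = u - v.
      by rewrite -Au hAC mulmxBl mul1mx opprB addrC subrK.
    have Zu : (4%:M - 2 *: C) *m u = 2 *: (u + v).
      rewrite mulmxBl mul_scalar_mx -scalemxAl CuE.
      by apply/colP => i; rewrite !mxE; ring.
    rewrite W0E Z0E hp0 Zu opprK subKr; split=> //.
    - by apply: mxOverZ; rewrite ?nnegrE.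
    - by apply: mxOverZ; rewrite ?nnegrE.
    - by rewrite mulNmx CuE; apply/colP => i; rewrite !mxE; ring.
    - apply/mxOverP => i j; rewrite !mxE posrE mulr_gt0 // ltr_pwDl //.
        by move/mxOverP: u0; apply.
      by move/mxOverP: v0; apply.
  have Zl_unit := Z_matrix_unitmx _ _ _ _ (Zoff l Z0) u0 Zu0.
  have Zinv0 := Z_matrix_invmx_nneg _ _ _ _ (Zoff l Z0) u0 Zu0.
  have WZ0 : - W l *m invmx (Z l) \is a mxOver Num.nneg by apply: mxOverM.
  have W'0 : - W l.+1 \is a mxOver Num.nneg.
    by rewrite hW opprK -[X in X \is a _]opprK -mulmxN -mulNmx -mulNmx mxOverM.
  have WZp0 : - (W l *m invmx (Z l) *m p l) \is a mxOver Num.nneg.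
    by rewrite -2!mulNmx mxOverM.
  (* Substituting [p = Z u + 2 W u] cancels [Z^-1 Z] in one term and makes [- W'] appear in the
     other. *)
  have WZp : W l *m invmx (Z l) *m p l = W l *m u - 2 *: (W l.+1 *m u).
    have -> : p l = Z l *m u + 2 *: (W l *m u) by rewrite Zu subrK.
    rewrite mulmxDr mulmxA mulmxKV // -scalemxAr mulmxA hW.
    by rewrite mulNmx scalerN opprK.
  have Z'u : Z l.+1 *m u = p l.+1 - 2 *: (W l.+1 *m u).
    rewrite hZ hp WZp mulmxDl -scalemxAl Zu.
    by apply/colP => i; rewrite !mxE; ring.
  (* In [Z' u = Z u + 2 W' u] the correction is nonpositive. Eliminating [W' u] by [WZp] and [W u]
     by [Zu] leaves only nonnegative terms, the first one positive; doubling avoids halves. *)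
  have Z'u2 : 2 *: (Z l.+1 *m u) =
      Z l *m u + p l + 2 *: - (W l *m invmx (Z l) *m p l).
    rewrite hZ WZp mulmxDl -scalemxAl Zu.
    by apply/colP => i; rewrite !mxE; ring.
  split=> //.
  - have -> : 4%:M - Z l.+1 = (4%:M - Z l) + 2 *: - W l.+1.
      by rewrite hZ opprD addrA scalerN.
    by rewrite mxOver_nnegD // mxOverZ ?nnegrE.
  - by rewrite hp -scalerN mxOver_nnegD // mxOverZ ?nnegrE.
  - apply/mxOverP => i j; rewrite posrE -(@pmulr_rgt0 _ 2) //.
    have -> : 2 * (Z l.+1 *m u) i j = (2 *: (Z l.+1 *m u)) i j by rewrite [RHS]mxE.
    rewrite Z'u2 -addrA mxE ltr_pwDl //; first by move/mxOverP: Zu0; apply.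
    suff /mxOverP : p l + 2 *: - (W l *m invmx (Z l) *m p l) \is a mxOver Num.nneg.
      by apply.
    by rewrite mxOver_nnegD // mxOverZ ?nnegrE.
split=> l; have [W0 Z0 p0 Zu Zu0] := inv l.
  exact: Z_matrix_unitmx _ _ _ _ (Zoff l Z0) u0 Zu0.
split; last first.
  split=> //; rewrite -Zu; apply/mxOverP => i j; rewrite nnegrE ltW //.
  by move/mxOverP: Zu0; apply.
exists 4, (4%:M - Z l); split=> //; first by rewrite opprB addrC subrK.
apply: (@spectral_radius_le _ _ _ u) => // i.
rewrite mulmxBl mul_scalar_mx !mxE lerBlDr lerDl ltW //.
by move/mxOverP: Zu0 => /(_ i 0); rewrite mxE.
Qed.
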